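(* Let $p\ge 5$ be an integer, let $x$ be a right vertex of $T_H$, and let $f$ be any $2p$ distance coloring of $T_H$. Then at least two distinct colors that do not appear on $V(D_x^{2p})$ appear on $\mathcal{F}_{x,p+1}\cup\mathcal{F}_{x,p+2}\cup\mathcal{F}_{x,p+3}$; that is, $$\Big|\, f\big(\mathcal{F}_{x,p+1}\cup\mathcal{F}_{x,p+2}\cup\mathcal{F}_{x,p+3}\big)\setminus f\big(V(D_x^{2p})\big)\Big|\ \ge 2 .$$ (In the paper's words: besides the new color needed on $\mathcal{F}_{x,p+1}$, a second new color must be introduced to color $\mathcal{F}_{x,p+2}\cup\mathcal{F}_{x,p+3}$.)
   Context: $T_H$ is the infinite hexagonal grid with vertex set $\mathbb{Z}^2$: $(i,j)$ is adjacent to $(i,j\pm1)$, and $(i,j)$ is adjacent to $(i+1,j)$ iff $i+j$ is even; no other edges. A vertex $(i,j)$ with $i+j$ even is called a right vertex. $d(u,v)$ is graph distance. For $l\in\mathbb{N}$, an $l$ distance coloring is a map $f:V(T_H)\to\{1,\dots,n\}$ with $f(u)\ne f(v)$ for all distinct $u,v$ with $d(u,v)\le l$. For a vertex $x$ and integer $k\ge0$, $\mathcal{F}_{x,k}=\{u\in V(T_H): d(x,u)=k\}$. $D_x^{2p}$ is the subgraph of $T_H$ induced by $\{w: d(w,x)\le p\}$. *)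

(* Defs.v *)
From Stdlib Require Import ZArith Arith Lia.
Open Scope Z_scope.

Definition vertex := (Z * Z)%type.

Definition hex_adj (u v : vertex) : Prop :=
  let (i, j) := u in let (i', j') := v in
  (i' = i /\ (j' = j + 1 \/ j' = j - 1))
  \/ (i' = i + 1 /\ j' = j /\ Z.Even (i + j))
  \/ (i = i' + 1 /\ j = j' /\ Z.Even (i' + j')).

Definition right_vertex (x : vertex) : Prop := Z.Even (fst x + snd x).

Inductive walk : vertex -> vertex -> nat -> Prop :=
| walk_nil : forall u, walk u u 0
| walk_cons : forall u w v k, hex_adj u w -> walk w v k -> walk u v (S k).

Definition hex_dist (u v : vertex) (k : nat) : Prop :=
  walk u v k /\ forall m, (m < k)%nat -> ~ walk u v m.

Definition distance_coloring (l n : nat) (f : vertex -> nat) : Prop :=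
  (forall u, (1 <= f u <= n)%nat) /\
  forall u v k, u <> v -> hex_dist u v k -> (k <= l)%nat -> f u <> f v.

Definition appears_on_shells (f : vertex -> nat) (x : vertex) (p c : nat) : Prop :=
  exists u k, hex_dist x u k /\ (p + 1 <= k <= p + 3)%nat /\ f u = c.

Definition appears_in_ball (f : vertex -> nat) (x : vertex) (p c : nat) : Prop :=
  exists w k, hex_dist w x k /\ (k <= p)%nat /\ f w = c.

(* Main.v *)
(* Give the vertices coordinates in Z^3 for which the graph distance is the l^1
   distance and x is the origin.  If [f] used at most one new colour, every colour
   class on the shells p+1, p+2, p+3 would be either the new class or a set of
   vertices at distance > 2p from each other and from the unique vertex w of the
   ball with that colour.  Weights [alpha] on the shells and [beta] on the shells
   p, p-1, p-2 are chosen so that a class belonging to w has total alpha-weight at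
   most [beta w], the new class has weight at most 7, yet the total of [alpha]
   exceeds the total of [beta] by 9.  The weights are, up to scaling, a dual
   solution of the linear program minimising the number of new colours.
   Geometrically the class bounds say that three vertices pairwise more than 2p
   apart sit near alternate corners of the hexagonal shells (whence the bound on the
   sum of their ranges), and that there are never four of them, at least for p >= 9;
   for p = 5, ..., 8 they are checked by enumerating the cliques. *)

Require Import Defs.
From Stdlib Require Import ZArith Arith Lia List FinFun Bool Classical.
Import ListNotations.
Open Scope Z_scope.

(** * Cube coordinates and the graph distance *)

(* [(a, b, c)] with [a + b + c] equal to 0 (right vertices) or 1 (left vertices);
   the edges change a single coordinate by 1. *)
Definition cube := (Z * Z * Z)%type.

Definition typ (u : cube) : Z := let '(a, b, c) := u in a + b + c.
Definition valid (u : cube) : Prop := 0 <= typ u <= 1.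
Definition nrm (u : cube) : Z := let '(a, b, c) := u in Z.abs a + Z.abs b + Z.abs c.
Definition dist (u v : cube) : Z :=
  let '(a, b, c) := u in let '(a', b', c') := v in
  Z.abs (a - a') + Z.abs (b - b') + Z.abs (c - c').
Definition top (u : cube) : Z := let '(a, b, c) := u in Z.max a (Z.max b c).
Definition bot (u : cube) : Z := let '(a, b, c) := u in Z.min a (Z.min b c).
Definition rng (u : cube) : Z := top u - bot u.
Definition rot (u : cube) : cube := let '(a, b, c) := u in (b, c, a).

(** For a right vertex [x], [typ u] is the parity of the coordinate sum of [place x u]. A step up
    raises [b] from a right vertex and lowers [c] from a left one. *)
Definition place (x : vertex) (u : cube) : vertex :=
  let '(a, b, c) := u in (fst x + a, snd x + b - c).

Ltac cube_unfold :=
  unfold valid, rng, top, bot, typ, nrm, dist, rot, place in *; cbn [fst snd] in *.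

Lemma place_surj (x v : vertex) :
  exists u, valid u /\ place x u = v.
Proof.
  destruct x as [x1 x2], v as [i j].
  pose proof (Z.div_mod (i - x1 + (j - x2)) 2 ltac:(lia)) as E.
  pose proof (Z.mod_pos_bound (i - x1 + (j - x2)) 2 ltac:(lia)) as B.
  set (s := (i - x1 + (j - x2)) mod 2) in *.
  set (q := (i - x1 + (j - x2)) / 2) in *.
  exists (i - x1, s + q - (i - x1), - q); cube_unfold; split; [lia|f_equal; lia].
Qed.

Lemma place_inj (x : vertex) (u v : cube) :
  valid u -> valid v -> place x u = place x v -> u = v.
Proof.
  destruct u as [[a b] c], v as [[a' b'] c']; cube_unfold; intros Hu Hv E.
  injection E as E1 E2. f_equal; [f_equal|]; lia.
Qed.

Lemma hex_adj_dist (x : vertex) (u v : cube) :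
  right_vertex x -> valid u -> valid v ->
  hex_adj (place x u) (place x v) <-> dist u v = 1.
Proof.
  destruct x as [x1 x2], u as [[a b] c], v as [[a' b'] c'].
  unfold right_vertex, hex_adj, Z.Even; cube_unfold; intros [m Hm] Hu Hv; split.
  - intros [[E1 E2]|[[E1 [E2 [n Hn]]]|[E1 [E2 [n Hn]]]]]; lia.
  - intros D.
    assert (C : a' = a \/ (a' = a + 1 /\ b' = b /\ c' = c)
                \/ (a = a' + 1 /\ b' = b /\ c' = c)) by lia.
    destruct C as [C|[C|C]].
    + left; lia.
    (* Here [typ u = 0], so the coordinate sum of [place x u] is [2 * m - 2 * c]. *)
    + right; left; repeat split; try lia. exists (m - c); lia.
    + right; right; repeat split; try lia. exists (m - c); lia.
Qed.

Lemma walk_lower (x : vertex) :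
  right_vertex x -> forall v w k, walk v w k ->
  forall u u', valid u -> valid u' -> place x u = v -> place x u' = w ->
  dist u u' <= Z.of_nat k.
Proof.
  intros Hx v w k H; induction H as [z|z y w k Hadj Hw IH]; intros u u' Hu Hu' E E'.
  - rewrite <- E' in E. apply place_inj in E; auto. subst u'.
    destruct u as [[a b] c]; cube_unfold; lia.
  - destruct (place_surj x y) as [m [Hm Em]].
    specialize (IH m u' Hm Hu' Em E').
    rewrite <- E, <- Em in Hadj. apply hex_adj_dist in Hadj; auto.
    destruct u as [[a b] c], u' as [[a' b'] c'], m as [[a2 b2] c2].
    cube_unfold; lia.
Qed.

(** A vertex of type 0 can only raise a coordinate, and since its sum is minimal some coordinate of
    [v] is larger. Type 1 is dual. *)
Lemma closer_neighbour (u v : cube) :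
  valid u -> valid v -> 0 < dist u v ->
  exists m, valid m /\ dist u m = 1 /\ dist m v = dist u v - 1.
Proof.
  destruct u as [[a b] c], v as [[a' b'] c']; cube_unfold; intros Hu Hv D.
  destruct (Z.eq_dec (a + b + c) 0) as [S|S].
  - assert (C : a < a' \/ b < b' \/ c < c') by lia.
    destruct C as [C|[C|C]];
      [exists (a + 1, b, c)|exists (a, b + 1, c)|exists (a, b, c + 1)]; lia.
  - assert (C : a' < a \/ b' < b \/ c' < c) by lia.
    destruct C as [C|[C|C]];
      [exists (a - 1, b, c)|exists (a, b - 1, c)|exists (a, b, c - 1)]; lia.
Qed.

Lemma walk_upper (x : vertex) :
  right_vertex x -> forall k u v, valid u -> valid v -> dist u v = Z.of_nat k ->
  walk (place x u) (place x v) k.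
Proof.
  intros Hx; induction k as [|k IH]; intros u v Hu Hv D.
  - replace v with u; [constructor|].
    destruct u as [[a b] c], v as [[a' b'] c']; cube_unfold.
    f_equal; [f_equal|]; lia.
  - destruct (closer_neighbour u v Hu Hv ltac:(lia)) as [m [Hm [D1 D2]]].
    apply walk_cons with (place x m).
    + apply hex_adj_dist; auto.
    + apply IH; auto; lia.
Qed.

Lemma hex_dist_place (x : vertex) (u v : cube) (k : nat) :
  right_vertex x -> valid u -> valid v ->
  hex_dist (place x u) (place x v) k <-> dist u v = Z.of_nat k.
Proof.
  intros Hx Hu Hv.
  assert (P : 0 <= dist u v)
    by (destruct u as [[a b] c], v as [[a' b'] c']; cube_unfold; lia).
  assert (W : walk (place x u) (place x v) (Z.to_nat (dist u v)))
    by (apply walk_upper; auto; lia).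
  split.
  - intros [H1 H2].
    pose proof (walk_lower x Hx _ _ _ H1 u v Hu Hv eq_refl eq_refl).
    destruct (Nat.lt_ge_cases (Z.to_nat (dist u v)) k) as [L|L]; [|lia].
    now apply H2 in L.
  - intros D. split.
    + rewrite D, Nat2Z.id in W; exact W.
    + intros m L H.
      pose proof (walk_lower x Hx _ _ _ H u v Hu Hv eq_refl eq_refl); lia.
Qed.

Lemma nrm_dist_origin (u : cube) : dist (0, 0, 0) u = nrm u.
Proof. destruct u as [[a b] c]; cube_unfold; lia. Qed.

Lemma place_origin (x : vertex) : place x (0, 0, 0) = x.
Proof. destruct x; cube_unfold; f_equal; lia. Qed.

Lemma hex_dist_center (x : vertex) (u : cube) (k : nat) :
  right_vertex x -> valid u -> hex_dist x (place x u) k <-> nrm u = Z.of_nat k.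
Proof.
  intros Hx Hu. rewrite <- (place_origin x) at 1.
  rewrite hex_dist_place, nrm_dist_origin; try assumption; [tauto|cube_unfold; lia].
Qed.

Lemma dist_sym (u v : cube) : dist u v = dist v u.
Proof. destruct u as [[a b] c], v as [[a' b'] c']; cube_unfold; lia. Qed.

Lemma appears_in_ball_place (f : vertex -> nat) (x : vertex) (p c : nat) :
  right_vertex x -> appears_in_ball f x p c ->
  exists w, valid w /\ nrm w <= Z.of_nat p /\ f (place x w) = c.
Proof.
  intros Hx [v [k [D [Hk E]]]].
  destruct (place_surj x v) as [w [Hw <-]].
  exists w; split; [exact Hw|split; [|exact E]].
  rewrite <- (place_origin x) in D at 2.
  rewrite hex_dist_place, dist_sym, nrm_dist_origin in D; try assumption; [lia|cube_unfold; lia].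
Qed.

(** * Weighted sums *)

Definition wsum {A : Type} (g : A -> Z) (l : list A) : Z :=
  fold_right (fun u s => g u + s) 0 l.

Lemma wsum_app {A : Type} (g : A -> Z) (l l' : list A) :
  wsum g (l ++ l') = wsum g l + wsum g l'.
Proof. unfold wsum; induction l as [|u l IH]; cbn; lia. Qed.

Lemma wsum_map {A B : Type} (h : A -> B) (g : B -> Z) (l : list A) :
  wsum g (map h l) = wsum (fun u => g (h u)) l.
Proof. unfold wsum; induction l as [|u l IH]; cbn; lia. Qed.

Lemma wsum_ext {A : Type} (g g' : A -> Z) (l : list A) :
  (forall u, g u = g' u) -> wsum g l = wsum g' l.
Proof. intros E; unfold wsum; induction l as [|u l IH]; cbn; rewrite ?E; lia. Qed.

Lemma wsum_opp {A : Type} (g : A -> Z) (l : list A) :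
  wsum (fun u => - g u) l = - wsum g l.
Proof. unfold wsum; induction l as [|u l IH]; cbn; lia. Qed.

Lemma wsum_add {A : Type} (g g' : A -> Z) (l : list A) :
  wsum (fun u => g u + g' u) l = wsum g l + wsum g' l.
Proof. unfold wsum; induction l as [|u l IH]; cbn [fold_right]; lia. Qed.

Lemma wsum_nonneg {A : Type} (g : A -> Z) (l : list A) :
  (forall u, In u l -> 0 <= g u) -> 0 <= wsum g l.
Proof.
  unfold wsum; induction l as [|u l IH]; intros G; cbn [fold_right]; [lia|].
  pose proof (G u (in_eq _ _)).
  specialize (IH (fun v Hv => G v (in_cons _ _ _ Hv))). lia.
Qed.

Lemma wsum_le {A : Type} (g g' : A -> Z) (l : list A) :
  (forall u, In u l -> g u <= g' u) -> wsum g l <= wsum g' l.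
Proof.
  unfold wsum; induction l as [|u l IH]; intros G; cbn [fold_right]; [lia|].
  pose proof (G u (in_eq _ _)).
  specialize (IH (fun v Hv => G v (in_cons _ _ _ Hv))). lia.
Qed.

Lemma le_wsum {A : Type} (g : A -> Z) (l : list A) (u : A) :
  (forall v, In v l -> 0 <= g v) -> In u l -> g u <= wsum g l.
Proof.
  intros G H. apply in_split in H as [l1 [l2 ->]].
  rewrite wsum_app. cbn [wsum fold_right].
  pose proof (wsum_nonneg g l1 ltac:(intros; apply G, in_app_iff; auto)).
  pose proof (wsum_nonneg g l2 ltac:(intros; apply G, in_app_iff; right; apply in_cons; auto)).
  unfold wsum in *; lia.
Qed.

(** As weights are nonnegative, repetitions in [K] can only enlarge the right side, so [K] may be a
    list of colours of vertices, with duplicates. *)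
Lemma wsum_le_color_classes {A : Type} (g : A -> Z) (h : A -> nat) (K : list nat) (l : list A) :
  (forall u, In u l -> 0 <= g u) -> (forall u, In u l -> In (h u) K) ->
  wsum g l <= wsum (fun k => wsum g (filter (fun u => Nat.eqb (h u) k) l)) K.
Proof.
  induction l as [|u l IH]; intros G I.
  - apply wsum_nonneg; intros; cbn; lia.
  - specialize (IH (fun v Hv => G v (in_cons _ _ _ Hv)) (fun v Hv => I v (in_cons _ _ _ Hv))).
    pose proof (G u (in_eq _ _)) as Gu.
    pose proof (le_wsum (fun k => if Nat.eqb (h u) k then g u else 0) K (h u)
      ltac:(intros k _; cbv beta; destruct (Nat.eqb (h u) k); lia) (I u (in_eq _ _))) as L.
    cbv beta in L. rewrite Nat.eqb_refl in L.
    rewrite (wsum_ext _ (fun k => (if Nat.eqb (h u) k then g u else 0)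
       + wsum g (filter (fun u => Nat.eqb (h u) k) l))).
    + rewrite wsum_add. unfold wsum at 1; cbn [fold_right]; fold (wsum g l). lia.
    + intros k; cbn [filter]; destruct (Nat.eqb (h u) k); reflexivity.
Qed.

(** * Shells *)

Definition interval (n : Z) : list Z := map Z.of_nat (seq 1 (Z.to_nat n)).

(* With [k = 2 * q + s], the shell of radius [k] is a hexagon whose corners have one
   coordinate 0; the other two are both positive on its long sides and both negative
   on its short sides.  [third] takes one of each kind of side and two corners. *)
Definition third (q s : Z) : list cube :=
  [(0, q + s, - q); (0, - q, q + s)]
  ++ map (fun t => (- q, t, q + s - t)) (interval (q + s - 1))
  ++ map (fun t => (q + s, - t, t - q)) (interval (q - 1)).

Definition shell (k : Z) : list cube :=
  let l := third (k / 2) (k mod 2) in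
  l ++ map rot l ++ map (fun u => rot (rot u)) l.

Lemma in_interval (n t : Z) : In t (interval n) <-> 1 <= t <= n.
Proof.
  unfold interval; rewrite in_map_iff; split.
  - intros [m [E H]]. apply in_seq in H. lia.
  - intros H. exists (Z.to_nat t). rewrite in_seq. lia.
Qed.

Lemma NoDup_interval (n : Z) : NoDup (interval n).
Proof.
  apply Injective_map_NoDup; [|apply seq_NoDup].
  intros i j; apply Nat2Z.inj.
Qed.

(* A fundamental domain of the rotation on the nonzero cube points. *)
Definition in_third (u : cube) : Prop :=
  let '(a, b, c) := u in
  (a = 0 /\ (b <> 0 \/ c <> 0)) \/ (1 <= b /\ 1 <= c) \/ (b <= -1 /\ c <= -1).

Lemma in_third_iff (q s : Z) (u : cube) :
  1 <= q -> 0 <= s <= 1 ->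
  In u (third q s) <-> typ u = s /\ nrm u = 2 * q + s /\ in_third u.
Proof.
  destruct u as [[a b] c]; intros Hq Hs; unfold third, in_third; cube_unfold.
  rewrite !in_app_iff, !in_map_iff; cbn [In].
  split.
  - intros [[E|[E|[]]]|[[t [E H]]|[t [E H]]]]; injection E as E1 E2 E3;
      try apply in_interval in H; lia.
  - intros [T [N [D|[D|D]]]].
    + left.
      assert (C : (b = q + s /\ c = - q) \/ (b = - q /\ c = q + s)) by lia.
      destruct D as [-> _]; destruct C as [[-> ->]|[-> ->]]; auto.
    + right; left; exists b; rewrite in_interval.
      split; [f_equal; [f_equal|]|]; lia.
    + right; right; exists (- b); rewrite in_interval.
      split; [f_equal; [f_equal|]|]; lia.
Qed.

Lemma NoDup_third (q s : Z) : 1 <= q -> 0 <= s <= 1 -> NoDup (third q s).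
Proof.
  intros Hq Hs. unfold third.
  repeat apply NoDup_app.
  - repeat constructor; cbn [In]; intros H.
    + destruct H as [H|[]]. injection H as H1 H2; lia.
    + destruct H.
  - apply Injective_map_NoDup; [|apply NoDup_interval].
    intros t t' E; now injection E.
  - apply Injective_map_NoDup; [|apply NoDup_interval].
    intros t t' E; injection E; lia.
  - intros u H1 H2; apply in_map_iff in H1, H2.
    destruct H1 as [t [<- H1]], H2 as [t' [E H2]]. injection E as E1 E2 E3; lia.
  - intros u H1 H2; apply in_app_iff in H2; rewrite !in_map_iff in H2.
    destruct H1 as [<-|[<-|[]]], H2 as [[t [E H2]]|[t [E H2]]];
      injection E as E1 E2 E3; lia.
Qed.

Lemma in_shell (k : Z) (u : cube) :
  2 <= k -> In u (shell k) <-> valid u /\ nrm u = k.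
Proof.
  intros Hk.
  pose proof (Z.div_mod k 2 ltac:(lia)) as E.
  pose proof (Z.mod_pos_bound k 2 ltac:(lia)) as B.
  unfold shell. set (q := k / 2) in *; set (s := k mod 2) in *.
  rewrite !in_app_iff, !in_map_iff. split.
  - intros [H|[[v [Ev H]]|[v [Ev H]]]];
      apply in_third_iff in H; try lia;
      [|destruct v as [[a' b'] c']|destruct v as [[a' b'] c']];
      destruct u as [[a b] c]; cube_unfold; try (injection Ev as E1 E2 E3); lia.
  - intros [V N]. destruct u as [[a b] c].
    assert (C : in_third (a, b, c) \/ in_third (c, a, b) \/ in_third (b, c, a))
      by (unfold in_third; cube_unfold; lia).
    destruct C as [C|[C|C]]; [left|right; left; exists (c, a, b)|right; right; exists (b, c, a)];
      rewrite in_third_iff by lia; cube_unfold; repeat split; try assumption; lia.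
Qed.

Lemma NoDup_shell (k : Z) : 2 <= k -> NoDup (shell k).
Proof.
  intros Hk.
  pose proof (Z.div_mod k 2 ltac:(lia)) as E.
  pose proof (Z.mod_pos_bound k 2 ltac:(lia)) as B.
  unfold shell. set (q := k / 2) in *; set (s := k mod 2) in *.
  assert (T : NoDup (third q s)) by (apply NoDup_third; lia).
  apply NoDup_app; [exact T|apply NoDup_app|].
  - apply Injective_map_NoDup; [|assumption].
    intros [[a b] c] [[a' b'] c'] H; injection H as -> -> ->; reflexivity.
  - apply Injective_map_NoDup; [|assumption].
    intros [[a b] c] [[a' b'] c'] H; injection H as -> -> ->; reflexivity.
  - intros u H1 H2; apply in_map_iff in H1, H2.
    destruct H1 as [v [E1 H1]], H2 as [v' [E2 H2]].
    apply in_third_iff in H1, H2; try lia.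
    destruct v as [[a b] c], v' as [[a' b'] c'], u as [[a2 b2] c2].
    unfold in_third in *; cube_unfold. injection E1 as <- <- <-. injection E2 as -> -> ->. lia.
  - intros u H1 H2; apply in_app_iff in H2; rewrite !in_map_iff in H2.
    apply in_third_iff in H1; try lia.
    destruct H2 as [[v [E2 H2]]|[v [E2 H2]]]; apply in_third_iff in H2; try lia;
    destruct v as [[a b] c], u as [[a2 b2] c2];
    unfold in_third in *; cube_unfold; injection E2 as -> -> ->; lia.
Qed.

(** The allowance [e] at both ends serves the long sides of the shell p+3, where [alpha] drops from
    2 to 1 next to the corners. *)
Lemma wsum_interval_lower (g : Z -> Z) (n m e : Z) :
  0 <= n -> 0 <= e ->
  (forall t, 1 <= t <= n -> m - (if (t =? 1) || (t =? n) then e else 0) <= g t) ->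
  m * n - 2 * e <= wsum g (interval n).
Proof.
  intros Hn He G.
  (* Induction on prefixes: the loss at the right end is charged only once the prefix reaches
     [n]. *)
  assert (K : forall k : nat, Z.of_nat k <= n ->
    m * Z.of_nat k - (if 1 <=? Z.of_nat k then e else 0)
      - (if n <=? Z.of_nat k then e else 0)
    <= wsum g (map Z.of_nat (seq 1 k))).
  { induction k as [|k IH]; intros Hk.
    - cbn [Z.of_nat seq map wsum fold_right].
      destruct (Z.leb_spec 1 0), (Z.leb_spec n 0); lia.
    - rewrite seq_S, map_app, wsum_app. cbn [map wsum fold_right].
      specialize (IH ltac:(lia)).
    specialize (G (Z.of_nat (1 + k)) ltac:(lia)).
      replace (Z.of_nat (S k)) with (Z.of_nat k + 1) by lia.
      replace (Z.of_nat (1 + k)) with (Z.of_nat k + 1) in * by lia.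
      destruct (Z.leb_spec 1 (Z.of_nat k)), (Z.leb_spec n (Z.of_nat k)),
        (Z.leb_spec 1 (Z.of_nat k + 1)), (Z.leb_spec n (Z.of_nat k + 1)),
        (Z.eqb_spec (Z.of_nat k + 1) 1), (Z.eqb_spec (Z.of_nat k + 1) n);
        cbn [orb] in G; lia. }
  specialize (K (Z.to_nat n) ltac:(lia)). rewrite Z2Nat.id in K by lia.
  unfold interval. destruct (1 <=? n), (n <=? n); lia.
Qed.

Lemma wsum_shell_lower (g : cube -> Z) (q s long e short corner : Z) :
  (forall u, g (rot u) = g u) -> 1 <= q -> 0 <= s <= 1 -> 0 <= e ->
  corner <= g (0, q + s, - q) -> corner <= g (0, - q, q + s) ->
  (forall t, 1 <= t <= q + s - 1 ->
     long - (if (t =? 1) || (t =? q + s - 1) then e else 0) <= g (- q, t, q + s - t)) ->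
  (forall t, 1 <= t <= q - 1 -> short <= g (q + s, - t, t - q)) ->
  3 * (2 * corner + long * (q + s - 1) - 2 * e + short * (q - 1))
  <= wsum g (shell (2 * q + s)).
Proof.
  intros Rg Hq Hs He C1 C2 L S.
  unfold shell.
  replace ((2 * q + s) / 2) with q by (apply Z.div_unique with s; lia).
  replace ((2 * q + s) mod 2) with s by (apply Z.mod_unique with q; lia).
  cbv zeta. rewrite !wsum_app, !wsum_map.
  rewrite (wsum_ext (fun u => g (rot u)) g) by exact Rg.
  rewrite (wsum_ext (fun u => g (rot (rot u))) g) by (intros; rewrite !Rg; reflexivity).
  unfold third. rewrite !wsum_app, !wsum_map. cbn [wsum fold_right].
  pose proof (wsum_interval_lower _ (q + s - 1) long e ltac:(lia) He L).
  pose proof (wsum_interval_lower (fun t => g (q + s, - t, t - q)) (q - 1) short 0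
                ltac:(lia) ltac:(lia)
                ltac:(intros t Ht; specialize (S t Ht); destruct (_ || _); lia)).
  cbv beta in *. lia.
Qed.

(** * Weights and pairwise far vertices *)

(* The second argument of [min] is 3, 2 on the shells p+1, p+2; on the shell p+3 it is
   2 on the long sides and 1 on the short ones.  The first one lowers the weight near
   the corners, where the range is largest.  [beta] is the dual: 3, 2 on the shells
   p, p-1 and, on the shell p-2, 2 on the short sides and 1 on the long ones. *)
Definition alpha (p : Z) (u : cube) : Z :=
  Z.min (p + 3 - rng u)
    (if nrm u =? p + 3 then if p + 3 <=? typ u - 2 * bot u then 2 else 1
     else p + 4 - nrm u).

Definition beta (p : Z) (w : cube) : Z :=
  Z.max (rng w - p + 4)
    (if nrm w =? p - 2 then if p - 2 <=? 2 * top w - typ w then 2 else 1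
     else nrm w - p + 3).

Definition far (p : Z) (u v : cube) : Prop := 2 * p < dist u v.

Inductive axis := A1 | A2 | A3.

(** The height along the first axis is a - b - c, and similarly for the others. On valid points the
    distance is the largest absolute difference of heights, because among the coordinate differences
    one has, up to zeros, the sign opposite to the other two. *)
Definition height (i : axis) (u : cube) : Z :=
  let '(a, b, c) := u in
  2 * match i with A1 => a | A2 => b | A3 => c end - typ u.

Definition above (p : Z) (u v : cube) : Prop :=
  exists i, 2 * p + 1 <= height i u - height i v.

Lemma far_above (p : Z) (u v : cube) :
  valid u -> valid v -> far p u v -> above p u v \/ above p v u.
Proof.
  intros Hu Hv F.
  enough (exists i, 2 * p + 1 <= height i u - height i v
                    \/ 2 * p + 1 <= height i v - height i u)
    by (unfold above; firstorder).
  destruct u as [[a b] c], v as [[a' b'] c']; unfold far in F.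
  destruct (Z_le_gt_dec (2 * p + 1) (Z.abs (height A1 (a, b, c) - height A1 (a', b', c'))));
    [exists A1; lia|].
  destruct (Z_le_gt_dec (2 * p + 1) (Z.abs (height A2 (a, b, c) - height A2 (a', b', c'))));
    [exists A2; lia|].
  exists A3. unfold height in *; cube_unfold; lia.
Qed.

Lemma abs_height_le (i : axis) (u : cube) :
  valid u -> Z.abs (height i u) <= nrm u.
Proof. destruct u as [[a b] c], i; unfold height; cube_unfold; lia. Qed.

Lemma height_sub_le_rng (i j : axis) (u : cube) : height i u - height j u <= 2 * rng u.
Proof. destruct u as [[a b] c], i, j; unfold height; cube_unfold; lia. Qed.

(* The three heights sum to 0 or -1, so two of them cannot both be extreme with the same sign. *)
Lemma high_unique (p : Z) (i j : axis) (u : cube) :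
  9 <= p -> valid u -> nrm u <= p + 3 ->
  p - 2 <= height i u -> p - 2 <= height j u -> i = j.
Proof.
  destruct u as [[a b] c], i, j; unfold height; cube_unfold; intros; reflexivity || lia.
Qed.

(** The third height would be at least 2p - 5, which exceeds the norm bound p + 3 once p >= 9. *)
Lemma low_unique (p : Z) (i j : axis) (u : cube) :
  9 <= p -> valid u -> nrm u <= p + 3 ->
  height i u <= - (p - 2) -> height j u <= - (p - 2) -> i = j.
Proof.
  destruct u as [[a b] c], i, j; unfold height; cube_unfold; intros; reflexivity || lia.
Qed.

Definition admissible (p : Z) (u : cube) : Prop := valid u /\ nrm u <= p + 3.

(** Heights are at most p + 3 in absolute value, so a drop of 2p + 1 starts at height at least p - 2
    and ends at most at -(p - 2). Thus [u] is high along [i] and [k], and [w] is low along [j] and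
    [k]; all axes agree, and the drop from [u] to [w] would be at least 4p + 2. *)
Lemma above_transitive_false (p : Z) (u v w : cube) :
  9 <= p -> admissible p u -> admissible p v -> admissible p w ->
  above p u v -> above p v w -> above p u w -> False.
Proof.
  intros Hp [Hu Nu] [Hv Nv] [Hw Nw] [i E] [j F] [k G].
  pose proof (abs_height_le i u Hu); pose proof (abs_height_le i v Hv).
  pose proof (abs_height_le j v Hv); pose proof (abs_height_le j w Hw).
  pose proof (abs_height_le k u Hu); pose proof (abs_height_le k w Hw).
  assert (i = k) by (apply (high_unique p i k u); trivial; lia).
  assert (j = k) by (apply (low_unique p j k w); trivial; lia).
  subst. lia.
Qed.

(** Add the three inequalities and regroup by vertex: 6p + 3 is at most twice the sum of the ranges,
    and integrality rounds up. *)
Lemma above_cyclic_rng (p : Z) (u v w : cube) :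
  above p u v -> above p v w -> above p w u ->
  3 * p + 2 <= rng u + rng v + rng w.
Proof.
  intros [i E] [j F] [k G].
  pose proof (height_sub_le_rng i k u).
  pose proof (height_sub_le_rng j i v).
  pose proof (height_sub_le_rng k j w).
  lia.
Qed.

(** [above] orients the three pairs; a transitive orientation is impossible, so it is one of the two
    cycles. *)
Lemma far_triangle_rng (p : Z) (u v w : cube) :
  9 <= p -> admissible p u -> admissible p v -> admissible p w ->
  far p u v -> far p u w -> far p v w -> 3 * p + 2 <= rng u + rng v + rng w.
Proof.
  intros Hp Au Av Aw Fuv Fuw Fvw.
  pose proof (proj1 Au); pose proof (proj1 Av); pose proof (proj1 Aw).
  apply far_above in Fuv, Fuw, Fvw; trivial.
  pose proof (above_transitive_false p) as T.
  pose proof (above_cyclic_rng p) as C.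
  destruct Fuv as [Fuv|Fuv], Fuw as [Fuw|Fuw], Fvw as [Fvw|Fvw];
    try match goal with
    | _ : above p ?a ?b, _ : above p ?b ?c, _ : above p ?a ?c |- _ =>
        exfalso; apply (T a b c); assumption
    end.
  - apply C; assumption.
  - specialize (C u w v Fuw Fvw Fuv); lia.
Qed.

(* Every tournament on four vertices contains a transitive triple. *)
Lemma far_no_four (p : Z) (u v w z : cube) :
  9 <= p -> admissible p u -> admissible p v -> admissible p w -> admissible p z ->
  far p u v -> far p u w -> far p u z -> far p v w -> far p v z -> far p w z -> False.
Proof.
  intros Hp Au Av Aw Az F1 F2 F3 F4 F5 F6.
  pose proof (proj1 Au); pose proof (proj1 Av).
  pose proof (proj1 Aw); pose proof (proj1 Az).
  apply far_above in F1, F2, F3, F4, F5, F6; trivial.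
  pose proof (above_transitive_false p) as T.
  destruct F1, F2, F3, F4, F5, F6;
    match goal with
    | _ : above p ?a ?b, _ : above p ?b ?c, _ : above p ?a ?c |- _ =>
        apply (T a b c); assumption
    end.
Qed.

(** The norms sum to at least 2p + 1, which compares the second arguments of [alpha] and [beta]
    except when [u] and [w] lie on long sides of the shells p+3 and p-2. *)
Lemma alpha_le_beta (p : Z) (u w : cube) :
  5 <= p -> valid u -> valid w -> p + 1 <= nrm u <= p + 3 -> nrm w <= p ->
  far p u w -> alpha p u <= beta p w.
Proof.
  intros Hp Hu Hw Nu Nw F.
  assert (T : nrm u + nrm w >= 2 * p + 1)
    by (destruct u as [[a b] c], w as [[a' b'] c']; unfold far in F; cube_unfold; lia).
  unfold alpha, beta.
  destruct (Z.eqb_spec (nrm u) (p + 3)); [|destruct (Z.eqb_spec (nrm w) (p - 2)); lia].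
  destruct (Z.eqb_spec (nrm w) (p - 2)); [|destruct (Z.leb_spec (p + 3) (typ u - 2 * bot u)); lia].
  destruct (Z.leb_spec (p + 3) (typ u - 2 * bot u)),
     (Z.leb_spec (p - 2) (2 * top w - typ w)); try lia.
  (* Being on a long side, [u] has a height -(p + 3). Below it also gets a height p + 3, so it is a
     corner and the first argument of [alpha] is small. *)
  enough (rng u >= p + 2) by lia.
  (* No height of [w] reaches p - 2, so [w] cannot be above [u]; hence [u] is above [w], at its
     maximal height. *)
  assert (exists i, height i u = p + 3) as [i Ei].
  { apply far_above in F as [[i E]|[i E]]; auto; exists i;
    pose proof (abs_height_le i u Hu); pose proof (abs_height_le i w Hw); [lia|].
    enough (height i w <= 2 * top w - typ w) by lia.
    destruct w as [[a b] c], i; unfold height; cube_unfold; lia. }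
  destruct u as [[a b] c], i; unfold height in *; cube_unfold; lia.
Qed.

(** * Bounds on colour classes *)

Definition outer (p : Z) : list cube := shell (p + 1) ++ shell (p + 2) ++ shell (p + 3).
Definition inner (p : Z) : list cube := shell p ++ shell (p - 1) ++ shell (p - 2).

Definition scattered (p : Z) (l : list cube) : Prop :=
  forall u v, In u l -> In v l -> u <> v -> far p u v.

Lemma in_outer (p : Z) (u : cube) :
  5 <= p -> In u (outer p) <-> valid u /\ p + 1 <= nrm u <= p + 3.
Proof.
  intros Hp; unfold outer; rewrite !in_app_iff, !in_shell by lia.
  split; [intuition lia|intros [V N]].
  assert (nrm u = p + 1 \/ nrm u = p + 2 \/ nrm u = p + 3) by lia. tauto.
Qed.

Lemma in_inner (p : Z) (u : cube) :
  5 <= p -> In u (inner p) <-> valid u /\ p - 2 <= nrm u <= p.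
Proof.
  intros Hp; unfold inner; rewrite !in_app_iff, !in_shell by lia.
  split; [intuition lia|intros [V N]].
  assert (nrm u = p \/ nrm u = p - 1 \/ nrm u = p - 2) by lia. tauto.
Qed.

Lemma NoDup_outer (p : Z) : 5 <= p -> NoDup (outer p).
Proof.
  intros Hp. unfold outer.
  apply NoDup_app; [apply NoDup_shell; lia|apply NoDup_app; try (apply NoDup_shell; lia)|];
    intros u; rewrite ?in_app_iff, !in_shell by lia; intuition lia.
Qed.

(* Maximal weight of a scattered subset of [l], for [n] at least the length of [l]. *)
Fixpoint max_scattered (p : Z) (n : nat) (l : list cube) : Z :=
  match n, l with
  | S n, u :: l =>
      Z.max (max_scattered p n l)
        (alpha p u + max_scattered p n (filter (fun v => 2 * p <? dist u v) l))
  | _, _ => 0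
  end.

Lemma wsum_le_max_scattered (p : Z) (n : nat) (l C : list cube) :
  (length l <= n)%nat -> NoDup C -> incl C l -> scattered p C ->
  wsum (alpha p) C <= max_scattered p n l.
Proof.
  revert l C; induction n as [|n IH]; intros l C Hn ND I S.
  - destruct l; [|cbn in Hn; lia]. apply incl_l_nil in I; subst C; cbn; lia.
  - destruct l as [|u l]; [apply incl_l_nil in I; subst C; cbn; lia|].
    cbn [max_scattered length] in *.
    destruct (classic (In u C)) as [H|H].
    + apply in_split in H as [C1 [C2 ->]].
      pose proof (NoDup_remove_1 _ _ _ ND) as ND'.
      pose proof (NoDup_remove_2 _ _ _ ND) as Hu.
      assert (L : wsum (alpha p) (C1 ++ C2)
                  <= max_scattered p n (filter (fun v => 2 * p <? dist u v) l)).
      { apply IH; [|exact ND'| |].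
        - pose proof (filter_length_le (fun v => 2 * p <? dist u v) l); lia.
        - intros v Hv.
          assert (Hv' : In v (C1 ++ u :: C2))
            by (rewrite in_app_iff in *; cbn; tauto).
          assert (u <> v) by (intros ->; auto).
          apply filter_In; split.
          + destruct (I v Hv'); [contradiction|assumption].
          + apply Z.ltb_lt, S; auto. apply in_elt.
        - intros v w Hv Hw. apply S; rewrite in_app_iff in *; cbn; tauto. }
      rewrite wsum_app in *; unfold wsum in *; cbn [fold_right]; lia.
    + enough (wsum (alpha p) C <= max_scattered p n l) by lia.
      apply IH; [lia|exact ND| |exact S].
      intros v Hv. destruct (I v Hv) as [->|]; [contradiction|assumption].
Qed.

Definition small_radius_check (p : Z) : bool :=
  let m := fun l => max_scattered p (length l) l in
  (m (outer p) <=? 7)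
  && forallb (fun w => m (filter (fun u => 2 * p <? dist u w) (outer p)) <=? beta p w)
       (inner p).

(* For small [p] there are exceptional configurations: four vertices within distance
   p+3 of the origin can be pairwise far when p is 5 or 6. *)
Lemma small_radius (p : Z) : 5 <= p < 9 -> small_radius_check p = true.
Proof.
  intros Hp. assert (C : p = 5 \/ p = 6 \/ p = 7 \/ p = 8) by lia.
  destruct C as [->|[->|[->| ->]]]; vm_compute; reflexivity.
Qed.

Lemma scattered_cons (p : Z) (u : cube) (l : list cube) :
  NoDup (u :: l) -> scattered p (u :: l) ->
  (forall v, In v l -> far p u v) /\ NoDup l /\ scattered p l.
Proof.
  intros ND S; apply NoDup_cons_iff in ND as [Hu ND].
  split; [|split; [exact ND|]].
  - intros v Hv; apply S; [apply in_eq|apply in_cons, Hv|congruence].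
  - intros v w Hv Hw; apply S; apply in_cons; assumption.
Qed.

Ltac mem := cbn [In]; tauto.

(** For p >= 9 there are at most three vertices. Two weigh at most 3 + 3; three weigh at most 3(p +
    3) - (3p + 2) = 7. *)
Lemma new_class_bound (p : Z) (C : list cube) :
  5 <= p -> NoDup C -> incl C (outer p) -> scattered p C -> wsum (alpha p) C <= 7.
Proof.
  intros Hp ND I S.
  destruct (Z_lt_le_dec p 9) as [L|L].
  { pose proof (small_radius p ltac:(lia)) as K.
    apply andb_prop in K as [K _]. apply Z.leb_le in K.
    eapply Z.le_trans; [|exact K]. apply wsum_le_max_scattered; auto. }
  assert (Ad : forall u, In u C -> admissible p u)
    by (intros u Hu; apply I, in_outer in Hu; [split; [|lia]; tauto|lia]).
  assert (B : forall u, In u C -> alpha p u <= 3 /\ alpha p u <= p + 3 - rng u).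
  { intros u Hu; apply I, in_outer in Hu; [|lia]. unfold alpha.
    destruct (Z.eqb_spec (nrm u) (p + 3)), (p + 3 <=? typ u - 2 * bot u); lia. }
  destruct C as [|u C]; [cbn; lia|].
  destruct (scattered_cons p u C ND S) as [Fu [ND1 S1]].
  pose proof (B u ltac:(mem)).
  destruct C as [|v C]; [cbn; lia|].
  destruct (scattered_cons p v C ND1 S1) as [Fv [ND2 S2]].
  pose proof (B v ltac:(mem)).
  destruct C as [|w C]; [cbn; lia|].
  destruct (scattered_cons p w C ND2 S2) as [Fw _].
  pose proof (B w ltac:(mem)).
  destruct C as [|z C].
  - enough (3 * p + 2 <= rng u + rng v + rng w) by (cbn; lia).
    apply (far_triangle_rng p); try (apply Ad; mem); [lia|apply Fu|apply Fu|apply Fv]; mem.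
  - exfalso.
    apply (far_no_four p u v w z); try (apply Ad; mem);
      [lia|apply Fu|apply Fu|apply Fu|apply Fv|apply Fv|apply Fw]; mem.
Qed.

(** For p >= 9, two vertices of the class form a far triangle with [w], so they weigh at most 2(p +
    3) - (3p + 2 - rng w) = rng w - p + 4, the first argument of [beta]. Three would make four
    pairwise far vertices with [w]. *)
Lemma old_class_bound (p : Z) (w : cube) (C : list cube) :
  5 <= p -> In w (inner p) -> NoDup C -> incl C (outer p) -> scattered p C ->
  (forall u, In u C -> far p u w) -> wsum (alpha p) C <= beta p w.
Proof.
  intros Hp Hw ND I S F.
  destruct (Z_lt_le_dec p 9) as [L|L].
  { pose proof (small_radius p ltac:(lia)) as K.
    apply andb_prop in K as [_ K]. rewrite forallb_forall in K.
    specialize (K w Hw). apply Z.leb_le in K.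
    eapply Z.le_trans; [|exact K]. apply wsum_le_max_scattered; auto.
    intros u Hu; apply filter_In; split; [auto|]. apply Z.ltb_lt, F, Hu. }
  apply in_inner in Hw; [|lia]. destruct Hw as [Vw Nw].
  assert (Aw : admissible p w) by (split; [assumption|lia]).
  assert (O : forall u, In u C -> valid u /\ p + 1 <= nrm u <= p + 3)
    by (intros u Hu; apply in_outer; auto).
  assert (Ad : forall u, In u C -> admissible p u)
    by (intros u Hu; destruct (O u Hu); split; [assumption|lia]).
  assert (B : forall u, In u C -> alpha p u <= p + 3 - rng u)
    by (intros; unfold alpha; lia).
  destruct C as [|u C].
  { unfold beta; cbn [wsum fold_right].
    destruct (Z.eqb_spec (nrm w) (p - 2)), (p - 2 <=? 2 * top w - typ w); lia. }
  destruct (scattered_cons p u C ND S) as [Fu [ND1 S1]].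
  pose proof (B u ltac:(mem)).
  destruct C as [|v C].
  { destruct (O u ltac:(mem)) as [Vu Nu].
    pose proof (alpha_le_beta p u w Hp Vu Vw Nu ltac:(lia) ltac:(apply F; mem)).
    cbn; lia. }
  destruct (scattered_cons p v C ND1 S1) as [Fv _].
  pose proof (B v ltac:(mem)).
  destruct C as [|z C].
  - enough (3 * p + 2 <= rng u + rng v + rng w) by (unfold beta; cbn; lia).
    apply (far_triangle_rng p); try (apply Ad; mem); trivial;
      [apply Fu|apply F|apply F]; mem.
  - exfalso.
    apply (far_no_four p u v z w); try (apply Ad; mem); trivial;
      [apply Fu|apply Fu|apply F|apply Fv|apply F|apply F]; mem.
Qed.

(** * The total weight *)

Lemma alpha_rot (p : Z) (u : cube) : alpha p (rot u) = alpha p u.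
Proof.
  unfold alpha.
  replace (rng (rot u)) with (rng u) by (destruct u as [[a b] c]; cube_unfold; lia).
  replace (nrm (rot u)) with (nrm u) by (destruct u as [[a b] c]; cube_unfold; lia).
  replace (typ (rot u)) with (typ u) by (destruct u as [[a b] c]; cube_unfold; lia).
  replace (bot (rot u)) with (bot u) by (destruct u as [[a b] c]; cube_unfold; lia).
  reflexivity.
Qed.

Lemma beta_rot (p : Z) (u : cube) : beta p (rot u) = beta p u.
Proof.
  unfold beta.
  replace (rng (rot u)) with (rng u) by (destruct u as [[a b] c]; cube_unfold; lia).
  replace (nrm (rot u)) with (nrm u) by (destruct u as [[a b] c]; cube_unfold; lia).
  replace (typ (rot u)) with (typ u) by (destruct u as [[a b] c]; cube_unfold; lia).
  replace (top (rot u)) with (top u) by (destruct u as [[a b] c]; cube_unfold; lia).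
  reflexivity.
Qed.

Ltac weights :=
  unfold alpha, beta; cube_unfold;
  repeat match goal with
  | |- context [?a =? ?b] => destruct (Z.eqb_spec a b)
  | |- context [?a <=? ?b] => destruct (Z.leb_spec a b)
  end; cbn [orb]; lia.

(** Comparing the shells p+1, p+2, p+3 with p, p-1, p-2 in this order, the bounds below differ by
    -3, 6 and 6, for either parity of p. *)
Lemma total_weight (p : Z) :
  5 <= p -> wsum (beta p) (inner p) + 9 <= wsum (alpha p) (outer p).
Proof.
  intros Hp.
  (* In each bound the constants are, in order, the weights at corners and on long sides, the loss
     [e], and the weight on short sides. [beta] is negated to be bounded from above. *)
  assert (A1 : forall q s, p + 1 = 2 * q + s -> 0 <= s <= 1 ->
    3 * (2 * 2 + 3 * (q + s - 1) - 2 * 0 + 3 * (q - 1))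
    <= wsum (alpha p) (shell (p + 1))).
  { intros q s E Hs; rewrite E.
    apply wsum_shell_lower; try lia; intros; [apply alpha_rot|weights..]. }
  assert (A2 : forall q s, p + 2 = 2 * q + s -> 0 <= s <= 1 ->
    3 * (2 * 1 + 2 * (q + s - 1) - 2 * 0 + 2 * (q - 1))
    <= wsum (alpha p) (shell (p + 2))).
  { intros q s E Hs; rewrite E.
    apply wsum_shell_lower; try lia; intros; [apply alpha_rot|weights..]. }
  assert (A3 : forall q s, p + 3 = 2 * q + s -> 0 <= s <= 1 ->
    3 * (2 * 0 + 2 * (q + s - 1) - 2 * 1 + 1 * (q - 1))
    <= wsum (alpha p) (shell (p + 3))).
  { intros q s E Hs; rewrite E.
    apply wsum_shell_lower; try lia; intros; [apply alpha_rot|weights..]. }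
  assert (B0 : forall q s, p = 2 * q + s -> 0 <= s <= 1 ->
    3 * (2 * (-4) + (-3) * (q + s - 1) - 2 * 0 + (-3) * (q - 1))
    <= wsum (fun u => - beta p u) (shell (p))).
  { intros q s E Hs; rewrite E.
    apply wsum_shell_lower; try lia; intros; [f_equal; apply beta_rot|weights..]. }
  assert (B1 : forall q s, p - 1 = 2 * q + s -> 0 <= s <= 1 ->
    3 * (2 * (-3) + (-2) * (q + s - 1) - 2 * 0 + (-2) * (q - 1))
    <= wsum (fun u => - beta p u) (shell (p - 1))).
  { intros q s E Hs; rewrite E.
    apply wsum_shell_lower; try lia; intros; [f_equal; apply beta_rot|weights..]. }
  assert (B2 : forall q s, p - 2 = 2 * q + s -> 0 <= s <= 1 ->
    3 * (2 * (-2) + (-1) * (q + s - 1) - 2 * 0 + (-2) * (q - 1))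
    <= wsum (fun u => - beta p u) (shell (p - 2))).
  { intros q s E Hs; rewrite E.
    apply wsum_shell_lower; try lia; intros; [f_equal; apply beta_rot|weights..]. }
  unfold inner, outer; rewrite !wsum_app.
  rewrite wsum_opp in B0, B1, B2.
  pose proof (Z.div_mod p 2 ltac:(lia)) as E.
  pose proof (Z.mod_pos_bound p 2 ltac:(lia)) as B.
  set (q := p / 2) in *; set (s := p mod 2) in *.
  assert (D : s = 0 \/ s = 1) by lia. clearbody q s. subst p.
  destruct D as [-> | ->].
  - specialize (A1 q 1 ltac:(lia) ltac:(lia)).
    specialize (A2 (q + 1) 0 ltac:(lia) ltac:(lia)).
    specialize (A3 (q + 1) 1 ltac:(lia) ltac:(lia)).
    specialize (B0 q 0 ltac:(lia) ltac:(lia)).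
    specialize (B1 (q - 1) 1 ltac:(lia) ltac:(lia)).
    specialize (B2 (q - 1) 0 ltac:(lia) ltac:(lia)).
    lia.
  - specialize (A1 (q + 1) 0 ltac:(lia) ltac:(lia)).
    specialize (A2 (q + 1) 1 ltac:(lia) ltac:(lia)).
    specialize (A3 (q + 2) 0 ltac:(lia) ltac:(lia)).
    specialize (B0 q 1 ltac:(lia) ltac:(lia)).
    specialize (B1 q 0 ltac:(lia) ltac:(lia)).
    specialize (B2 (q - 1) 1 ltac:(lia) ltac:(lia)).
    lia.
Qed.

Lemma alpha_nonneg (p : Z) (u : cube) : 5 <= p -> In u (outer p) -> 0 <= alpha p u.
Proof.
  intros Hp H; apply in_outer in H; [|lia].
  assert (rng u <= nrm u) by (destruct u as [[a b] c]; cube_unfold; lia).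
  unfold alpha.
  destruct (Z.eqb_spec (nrm u) (p + 3)), (p + 3 <=? typ u - 2 * bot u); lia.
Qed.

(** * Colour classes against the total weight *)

Theorem theorem2 (p n : nat) (x : vertex) (f : vertex -> nat) :
  (5 <= p)%nat ->
  right_vertex x ->
  distance_coloring (2 * p) n f ->
  exists c1 c2 : nat, c1 <> c2 /\
    appears_on_shells f x p c1 /\ ~ appears_in_ball f x p c1 /\
    appears_on_shells f x p c2 /\ ~ appears_in_ball f x p c2.
Proof.
  intros Hp Hx [_ Hf].
  set (P := Z.of_nat p). assert (HP : 5 <= P) by lia.
  set (h := fun u => f (place x u)).
  assert (F : forall u v, valid u -> valid v -> u <> v -> h u = h v -> far P u v).
  { intros u v Hu Hv N E. unfold far.
    destruct (Z_lt_le_dec (2 * P) (dist u v)) as [L|L]; [exact L|exfalso].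
    refine (Hf (place x u) (place x v) (Z.to_nat (dist u v)) _ _ _ E).
    - intros E'; apply N, (place_inj x); assumption.
    - apply hex_dist_place; trivial.
      destruct u as [[a b] c], v as [[a' b'] c']; cube_unfold; lia.
    - lia. }
  assert (Sh : forall u, In u (outer P) -> appears_on_shells f x p (h u)).
  { intros u Hu; apply in_outer in Hu as [Vu Nu]; [|lia].
    exists (place x u), (Z.to_nat (nrm u)).
    rewrite hex_dist_center by assumption. repeat split; lia. }
  apply NNPP; intros Hno.
  (* Two distinct new colours are excluded, so a single [c] accounts for all colours absent from the
     ball. *)
  assert (New : exists c, forall u, In u (outer P) ->
                 h u = c \/ appears_in_ball f x p (h u)).
  { destruct (classic (exists u, In u (outer P) /\ ~ appears_in_ball f x p (h u)))
      as [[u [Hu Nu]]|None].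
    - exists (h u); intros v Hv. apply NNPP; intros Nv.
      apply Hno; exists (h v), (h u); repeat split; auto; tauto.
    (* Without any new colour, 0 is an arbitrary default; its class obeys the same bound 7. *)
    - exists 0%nat; intros v Hv; right. apply NNPP; intros Nv; apply None; eauto. }
  destruct New as [c New].
  assert (Classes : forall k, let C := filter (fun u => Nat.eqb (h u) k) (outer P) in
    NoDup C /\ incl C (outer P) /\ scattered P C).
  { intros k; cbv zeta; split; [|split].
    - apply NoDup_filter, NoDup_outer; lia.
    - apply incl_filter.
    - intros u v Hu Hv N. apply filter_In in Hu as [Hu Eu], Hv as [Hv Ev].
      apply in_outer in Hu, Hv; try lia. apply Nat.eqb_eq in Eu, Ev.
      apply F; try tauto; congruence. }
  (* A ball vertex sharing its colour with a vertex of norm at most p + 3 is more than 2p away from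
     it, hence has norm at least p - 2 and lies in [inner]. *)
  assert (Cover : forall u, In u (outer P) -> In (h u) (c :: map h (inner P))).
  { intros u Hu. destruct (New u Hu) as [<-|B]; [apply in_eq|apply in_cons].
    destruct (appears_in_ball_place f x p (h u) Hx B) as [w [Vw [Nw E]]].
    apply in_outer in Hu as [Vu Nu]; [|lia].
    rewrite <- E; apply (in_map h), in_inner; [lia|split; [exact Vw|]].
    assert (far P u w) as D by (apply F; auto; intros ->; lia).
    unfold far in D. destruct u as [[a b] c'], w as [[a' b'] c'']; cube_unfold; lia. }
  pose proof (wsum_le_color_classes (alpha P) h _ (outer P)
    (fun u Hu => alpha_nonneg P u HP Hu) Cover) as Count.
  unfold wsum in Count at 2; cbn [fold_right] in Count.
  fold (wsum (fun k => wsum (alpha P) (filter (fun u => Nat.eqb (h u) k) (outer P)))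
    (map h (inner P))) in Count.
  rewrite wsum_map in Count.
  destruct (Classes c) as [ND [I S]].
  pose proof (new_class_bound P _ HP ND I S) as Bnew.
  assert (Bold : wsum (fun w => wsum (alpha P)
      (filter (fun u => Nat.eqb (h u) (h w)) (outer P))) (inner P) <= wsum (beta P) (inner P)).
  { apply wsum_le; intros w Hw. destruct (Classes (h w)) as [NDw [Iw Sw]].
    apply old_class_bound; trivial.
    intros u Hu; apply filter_In in Hu as [Hu E]; apply Nat.eqb_eq in E.
    apply in_outer in Hu; [|lia]. apply in_inner in Hw; [|lia].
    apply F; try tauto. intros ->; lia. }
  (* The outer weight is at most 7 plus the total of [beta], yet at least 9 plus that total. *)
  pose proof (total_weight P HP). lia.
Qed.
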